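(* For $i=1,2$ let $\Sigma_i=(S_i,\sigma_i,\mu_i)$ be a signed graph of order $n_i$ with marking $\mu_i$, and let $\Sigma_{i\mu}$ be its $\mu$-signed graph. Let $\lambda'_{11},\dots,\lambda'_{1n_1}$ be the eigenvalues of $A(\Sigma_{1\mu})$. Write the signed adjacency coronal of $\Sigma_{2\mu}$ in reduced form $\chi_{A(\Sigma_{2\mu})}(x)=P'_{d-1}(x)/F'_d(x)$, and let $R'_{n_2-d}(x)$ be the corresponding greatest common divisor, so that $\det(xI_{n_2}-A(\Sigma_{2\mu}))=R'_{n_2-d}(x)F'_d(x)$. Then the characteristic polynomial of the adjacency matrix of the product $\Sigma_1\circledast\Sigma_2$ is $$f(A(\Sigma_1\circledast\Sigma_2),x)=x^{n_1(n_2-1)}\,R'_{n_2-d}(x)^{n_1}\prod_{i=1}^{n_1}\Big[xF'_d(x)-n_2\big(\lambda'_{1i}F'_d(x)+P'_{d-1}(x)\big)\Big].$$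
   Context: A signed graph is a triple $\Sigma=(S,\sigma,\mu)$ where $S=(V,E)$ is a finite simple undirected graph, $\sigma:E\to\{+1,-1\}$ is a signature and $\mu:V\to\{+1,-1\}$ is a marking. Its adjacency matrix $A(\Sigma)$ has $(i,j)$ entry $\sigma(u_iu_j)$ if $u_i\sim u_j$ and $0$ otherwise. The $\mu$-signed graph of $\Sigma$ is $\Sigma_\mu=(S,\sigma_\mu,\mu)$ with $\sigma_\mu(uv)=\mu(u)\mu(v)$ for every edge $uv$. Write $\mu(\Sigma)\in\{\pm1\}^n$ for the column vector of vertex marks. The signed adjacency coronal of $\Sigma_\mu$ (order $n$) is the rational function $\chi_{A(\Sigma_\mu)}(x)=\mu(\Sigma)^T(xI_n-A(\Sigma_\mu))^{-1}\mu(\Sigma)$. Writing it as $p(x)/f(x)$ with $f(x)=\det(xI_n-A(\Sigma_\mu))$ and $p(x)=\mu(\Sigma)^T\mathrm{adj}(xI_n-A(\Sigma_\mu))\mu(\Sigma)$, let $R'_{n-d}(x)$ be the monic greatest common divisor of $p$ and $f$ (of degree $n-d$), $F'_d=f/R'_{n-d}$ (degree $d$) and $P'_{d-1}=p/R'_{n-d}$ (degree $d-1$). Product $\Sigma_1\circledast\Sigma_2$: if $\Sigma_1$ has vertices $u_1,\dots,u_{n_1}$ and $\Sigma_2$ has vertices $v_1,\dots,v_{n_2}$, then $\Sigma_1\circledast\Sigma_2$ has the $2n_1n_2$ vertices $a_{ij},b_{ij}$ ($1\le i\le n_1$, $1\le j\le n_2$) with marking $\mu(a_{ij})=\mu_1(u_i)$,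 $\mu(b_{ij})=\mu_2(v_j)$. Its edges are: $a_{ik}a_{jl}$ for all $1\le k,l\le n_2$ whenever $u_iu_j\in E(\Sigma_1)$; $b_{ri}b_{rj}$ for all $1\le r\le n_1$ whenever $v_iv_j\in E(\Sigma_2)$; and $a_{ip}b_{iq}$ for all $1\le i\le n_1$, $1\le p,q\le n_2$. Every edge $xy$ of the product gets sign $\mu(x)\mu(y)$. *)

(* Defs.v *)
From HB Require Import structures.
From mathcomp Require Import all_boot all_order all_algebra fraction.
Set Implicit Arguments.
Unset Strict Implicit.
Unset Printing Implicit Defensive.
Import Order.TTheory GRing.Theory Num.Theory.
Local Open Scope ring_scope.

Notation "x %:F" := (@FracField.tofrac _ x) : ring_scope.

Record simple_graph (V : finType) := SimpleGraph {
  adj : rel V;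
  adj_sym : symmetric adj;
  adj_irr : irreflexive adj
}.

Definition is_sign (z : int) : Prop := z = 1 \/ z = -1.

Lemma is_signM (y z : int) : is_sign y -> is_sign z -> is_sign (y * z).
Proof.
by case=> ->; case=> ->; rewrite ?mul1r ?mulr1 ?mulrNN ?mulr1; [left|right|right|left].
Qed.

(* The signature is a function on edges: only the values [sigma u v] with
   [adj graph u v] are meaningful. *)
Record signed_graph (V : finType) := SignedGraph {
  graph :> simple_graph V;
  sigma : V -> V -> int;
  mark : V -> int;
  sigma_sym : forall u v, adj graph u v -> sigma u v = sigma v u;
  sigma_sign : forall u v, adj graph u v -> is_sign (sigma u v);
  mark_sign : forall u, is_sign (mark u)
}.

Section MarkSigned.
Variables (V : finType) (G : simple_graph V) (mu : V -> int).
Hypothesis mu_sign : forall u, is_sign (mu u).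

Lemma mark_sigma_sym u v : adj G u v -> mu u * mu v = mu v * mu u.
Proof. by rewrite mulrC. Qed.

Lemma mark_sigma_sign u v : adj G u v -> is_sign (mu u * mu v).
Proof. by move=> _; apply: is_signM. Qed.

Definition marked_graph : signed_graph V :=
  @SignedGraph V G (fun u v => mu u * mu v) mu
    mark_sigma_sym mark_sigma_sign mu_sign.
End MarkSigned.

Definition mu_signed (V : finType) (S : signed_graph V) : signed_graph V :=
  marked_graph (graph S) (@mark_sign V S).

Section Product.
Variables (V1 V2 : finType) (S1 : signed_graph V1) (S2 : signed_graph V2).

(* [inl (u_i, v_j)] is the vertex a_ij and [inr (u_i, v_j)] the vertex b_ij. *)
Definition prod_vertex : finType := ((V1 * V2) + (V1 * V2))%type.

Definition prod_adj (x y : prod_vertex) : bool :=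
  match x, y with
  | inl (i, _), inl (j, _) => adj S1 i j
  | inr (r, i), inr (s, j) => (r == s) && adj S2 i j
  | inl (i, _), inr (j, _) => i == j
  | inr (i, _), inl (j, _) => i == j
  end.

Lemma prod_adj_sym : symmetric prod_adj.
Proof.
move=> [[i k]|[i k]] [[j l]|[j l]] /=.
- exact: adj_sym.
- exact: eq_sym.
- exact: eq_sym.
- by rewrite eq_sym adj_sym.
Qed.

Lemma prod_adj_irr : irreflexive prod_adj.
Proof.
by move=> [[i k]|[i k]] /=; rewrite ?(adj_irr S1) ?(adj_irr S2) ?andbF.
Qed.

Definition prod_graph : simple_graph prod_vertex :=
  SimpleGraph prod_adj_sym prod_adj_irr.

Definition prod_mark (x : prod_vertex) : int :=
  match x with
  | inl (i, _) => mark S1 i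
  | inr (_, j) => mark S2 j
  end.

Lemma prod_mark_sign x : is_sign (prod_mark x).
Proof. by case: x => [[i j]|[i j]]; apply: mark_sign. Qed.

Definition sgprod : signed_graph prod_vertex :=
  marked_graph prod_graph prod_mark_sign.
End Product.

Section Coronal.
Variables (R : rcfType) (V : finType) (S : signed_graph V).

(* The ordering u_1, ..., u_n of the vertices is the enumeration of [V]. *)
Definition adjmx : 'M[R]_#|V| :=
  \matrix_(i, j) if adj S (enum_val i) (enum_val j)
                 then (sigma S (enum_val i) (enum_val j))%:~R else 0.

Definition markv : 'cV[R]_#|V| := \col_i (mark S (enum_val i))%:~R.

Definition coronal : {fraction {poly R}} :=
  let mu := map_mx (fun a : R => a%:P%:F) markv in
  (mu^T *m invmx (('X%:F)%:M - map_mx (fun a : R => a%:P%:F) adjmx) *m mu) 0 0.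

Definition coronal_num : {poly R} :=
  ((map_mx polyC markv)^T *m \adj (char_poly_mx adjmx) *m map_mx polyC markv) 0 0.

Definition coronal_den : {poly R} := char_poly adjmx.

Definition monic_gcd (p q : {poly R}) : {poly R} :=
  (lead_coef (gcdp p q))^-1 *: gcdp p q.

(* P is P'_{d-1}, F is F'_d and G is R'_{n-d}.  The degrees of P and G
   are consequences. *)
Definition coronal_reduced_form (d : nat) (P F G : {poly R}) : Prop :=
  [/\ coronal = P%:F / F%:F,
      coprimep P F,
      size F = d.+1,
      G = monic_gcd coronal_num coronal_den &
      coronal_den = G * F].

Lemma char_poly_mx_frac :
  ('X%:F)%:M - map_mx (fun a : R => a%:P%:F) adjmx
  = map_mx (@FracField.tofrac {poly R}) (char_poly_mx adjmx).
Proof.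
apply/matrixP=> i j; rewrite !mxE tofracB; congr (_ - _).
by case: (_ == _); rewrite ?mulr1n ?mulr0n ?tofrac0.
Qed.

Lemma coronal_den_neq0 : coronal_den != 0.
Proof. exact/monic_neq0/char_poly_monic. Qed.

Lemma coronalE : coronal = coronal_num%:F / coronal_den%:F.
Proof.
rewrite /coronal char_poly_mx_frac /coronal_num /coronal_den /char_poly.
set M := char_poly_mx _; set t := @FracField.tofrac {poly R}.
have dM : \det (map_mx t M) = (\det M)%:F by rewrite det_map_mx.
have uM : map_mx t M \in unitmx.
  by rewrite unitmxE dM unitfE tofrac_eq0 coronal_den_neq0.
have -> : map_mx (fun a : R => a%:P%:F) markv = map_mx t (map_mx polyC markv).
  by apply/matrixP=> i j; rewrite !mxE.
rewrite /invmx uM dM !map_trmx -map_mx_adj -scalemxAr -scalemxAl -!(map_mxM (@FracField.tofrac {poly R})).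
by rewrite mxE [X in _ * X]mxE mulrC.
Qed.

Lemma coronal_reduced_form_exists :
  exists d P F G, coronal_reduced_form d P F G.
Proof.
pose G := monic_gcd coronal_num coronal_den.
have g0 : gcdp coronal_num coronal_den != 0.
  by rewrite gcdp_eq0 (negbTE coronal_den_neq0) andbF.
have l0 : (lead_coef (gcdp coronal_num coronal_den))^-1 != 0.
  by rewrite invr_eq0 lead_coef_eq0.
have Gg : G %= gcdp coronal_num coronal_den by apply: eqp_scale.
have G0 : G != 0 by rewrite scaler_eq0 negb_or l0.
have nG : coronal_num = coronal_num %/ G * G.
  by rewrite divpK // (eqp_dvdl _ Gg) dvdp_gcdl.
have dG : coronal_den = G * (coronal_den %/ G).
  by rewrite mulrC divpK // (eqp_dvdl _ Gg) dvdp_gcdr.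
have F0 : coronal_den %/ G != 0.
  by apply: contraNneq coronal_den_neq0 => e; rewrite dG e mulr0.
exists (size (coronal_den %/ G)).-1, (coronal_num %/ G), (coronal_den %/ G), G.
split=> //.
- rewrite coronalE; apply/eqP.
  rewrite eqr_div ?tofrac_eq0 ?coronal_den_neq0 // -!tofracM tofrac_eq.
  by rewrite {1}nG -mulrA -dG.
- have l0' := l0; rewrite -invr_eq0 in l0'.
  rewrite /G /monic_gcd (divpZr _ _ l0) (divpZr coronal_den _ l0).
  rewrite (coprimepZl _ _ l0') (coprimepZr _ _ l0').
  by rewrite coprimep_div_gcd // coronal_den_neq0 orbT.
- by rewrite prednK // lt0n size_poly_eq0.
Qed.
End Coronal.

(* [lam] lists the eigenvalues of [A] with algebraic multiplicity. *)
Definition eigenvalues (R : rcfType) n (A : 'M[R]_n) (lam : 'I_n -> R) : Prop :=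
  char_poly A = \prod_(i < n) ('X - (lam i)%:P).

(* Main.v *)
(** Order the vertices as the a's followed by the b's and work over the
    fractions of R[x].  The matrix x - A of the product is then a 2 x 2 block
    matrix whose bb block is I (x) (x - A2), of determinant f2^n1.  Since the
    marks square to 1, its Schur complement is x - (A1 + chi I) (x) J, with chi
    the coronal of the second graph and J the all-ones matrix of order n2.
    Factoring J through its rank one reduces this to x^(n1 (n2 - 1)) times
    det (x - n2 (A1 + chi I)), which is the product of the factors
    x - n2 (lambda_i + chi); the f2^n1 = (R' F')^n1 clears the denominators
    of chi = P' / F'. *)
Require Import Defs.
From HB Require Import structures.
From mathcomp Require Import all_boot all_order all_algebra fraction.
From mathcomp Require Import fingroup perm ring.
Set Implicit Arguments.
Unset Strict Implicit.
Unset Printing Implicit Defensive.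
Import Order.TTheory GRing.Theory Num.Theory.
Local Open Scope ring_scope.

(** * Determinant identities over a commutative ring *)

Section Determinants.
Variable K : comNzRingType.

(** Block elimination: a block upper triangular matrix times a unipotent block lower triangular one.
    The inverse of [D] is a parameter, so no division in [K] is required. *)
Lemma det_schur m n (A : 'M[K]_m) (B : 'M_(m, n)) (C : 'M_(n, m))
    (D D' : 'M_n) :
  D *m D' = 1%:M ->
  \det (block_mx A B C D) = \det D * \det (A - B *m D' *m C).
Proof.
move=> DD'.
have -> : block_mx A B C D = block_mx (A - B *m D' *m C) B 0 D
                             *m block_mx 1%:M 0 (D' *m C) 1%:M.
  rewrite mulmx_block !mulmx1 !mulmx0 ?mul0mx !add0r.
  by rewrite [D *m (_ *m _)]mulmxA DD' mul1mx [B *m (_ *m _)]mulmxA subrK.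
by rewrite det_mulmx det_ublock det_lblock !det1 !mulr1 mulrC.
Qed.

(* Sylvester's identity; both sides come from the block matrix
   [[x, U], [W, 1]]. *)
Lemma det_scalar_sub_mulC m n (x : K) (U : 'M_(m, n)) (W : 'M_(n, m)) :
  x ^+ n * \det (x%:M - U *m W) = x ^+ m * \det (x%:M - W *m U).
Proof.
have := det_schur x%:M U W (mulmx1 1%:M).
rewrite det1 mul1r mulmx1 => <-.
(* Multiplying by this matrix on the right turns the upper right block into [- x U + U x = 0] and
   the lower right one into [x - W U]. *)
have <- : \det (block_mx 1%:M (- U) 0 x%:M) = x ^+ n.
  by rewrite det_ublock det1 mul1r det_scalar.
rewrite mulrC -det_mulmx mulmx_block !mulmx1 !mulmx0 mul1mx !addr0.
rewrite mul_scalar_mx mul_mx_scalar scalerN addNr mulmxN addrC.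
by rewrite det_lblock det_scalar addrC.
Qed.

(** Rows and columns undergo the same permutation, so its sign enters squared. *)
Lemma det_mxsub_bij m n (f : 'I_n -> 'I_m) (A : 'M[K]_m) :
  bijective f -> \det (mxsub f f A) = \det A.
Proof.
move=> f_bij; have /esym eq_mn : n = m.
  by rewrite -(card_ord n) (bij_eq_card f_bij) card_ord.
case: n / eq_mn f f_bij => f f_bij.
pose s := perm (bij_inj f_bij).
have -> : mxsub f f A = row_perm s (col_perm s A).
  by apply/matrixP=> i j; rewrite !mxE !permE.
rewrite row_permE col_permE !det_mulmx !det_perm odd_permV.
by rewrite mulrCA -expr2 sqrr_sign mulr1.
Qed.

End Determinants.

(** * Matrices indexed by finite types *)

Section MatricesOverFinTypes.
Variable K : comNzRingType.

(** Entries are given on vertices rather than ordinals, so that blocks and Kronecker products are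
    read off sums and products of types. *)
Definition finmx (T1 T2 : finType) (f : T1 -> T2 -> K) : 'M[K]_(#|T1|, #|T2|) :=
  \matrix_(i, j) f (enum_val i) (enum_val j).

Lemma eq_finmx (T1 T2 : finType) (f g : T1 -> T2 -> K) :
  f =2 g -> finmx f = finmx g.
Proof. by move=> fg; apply/matrixP=> i j; rewrite !mxE fg. Qed.

Lemma finmx_rank (T1 T2 : finType) (A : 'M[K]_(#|T1|, #|T2|)) :
  finmx (fun x y => A (enum_rank x) (enum_rank y)) = A.
Proof. by apply/matrixP=> i j; rewrite !mxE !enum_valK. Qed.

Lemma mulmx_finmx (T1 T2 T3 : finType) (f : T1 -> T2 -> K) (g : T2 -> T3 -> K) :
  finmx f *m finmx g = finmx (fun x y => \sum_z f x z * g z y).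
Proof.
apply/matrixP=> i j; rewrite !mxE [RHS](reindex _ (onW_bij _ (enum_val_bij T2))).
by apply: eq_bigr => k _; rewrite !mxE.
Qed.

Lemma scalar_finmx (T : finType) (a : K) :
  a%:M = finmx (fun x y : T => a *+ (x == y)).
Proof. by apply/matrixP=> i j; rewrite !mxE (inj_eq enum_val_inj). Qed.

Lemma finmxB (T1 T2 : finType) (f g : T1 -> T2 -> K) :
  finmx f - finmx g = finmx (fun x y => f x y - g x y).
Proof. by apply/matrixP=> i j; rewrite !mxE. Qed.

Lemma det_finmx_ord n (T : finType) (e : 'I_n -> T) (f : T -> T -> K) :
  bijective e -> \det (\matrix_(i, j) f (e i) (e j)) = \det (finmx f).
Proof.
move=> e_bij.
rewrite -(det_mxsub_bij (f := fun i => enum_rank (e i))); last first.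
  exact: bij_comp (enum_rank_bij T) e_bij.
by congr (\det _); apply/matrixP=> i j; rewrite !mxE !enum_rankK.
Qed.

Lemma det_finmx_bij (T T' : finType) (h : T' -> T) (f : T -> T -> K) :
  bijective h ->
  \det (finmx (fun x y => f (h x) (h y))) = \det (finmx f).
Proof.
by move=> h_bij; rewrite -(det_finmx_ord _ (bij_comp h_bij (enum_val_bij T'))).
Qed.

(** Listing [T1] and then [T2] differs from the enumeration of the sum type only by a bijection,
    which preserves the determinant. *)
Lemma det_finmx_sum (T1 T2 : finType) (f : T1 + T2 -> T1 + T2 -> K) :
  \det (finmx f) =
  \det (block_mx (finmx (fun x y => f (inl x) (inl y)))
                 (finmx (fun x y => f (inl x) (inr y)))
                 (finmx (fun x y => f (inr x) (inl y)))
                 (finmx (fun x y => f (inr x) (inr y)))).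
Proof.
pose e (i : 'I_(#|T1| + #|T2|)) : T1 + T2 :=
  match split i with inl j => inl (enum_val j) | inr j => inr (enum_val j) end.
have e_bij : bijective e.
  exists (fun z => unsplit match z with inl x => inl (enum_rank x)
                                      | inr y => inr (enum_rank y) end).
    move=> i; rewrite /e -[RHS]splitK; congr unsplit.
    by case: (split i) => j; rewrite enum_valK.
  by move=> [x|y]; rewrite /e unsplitK enum_rankK.
rewrite -(det_finmx_ord _ e_bij); congr (\det _).
apply/matrixP=> i j; rewrite [LHS]mxE /e -[i in RHS]splitK -[j in RHS]splitK.
by case: (split i) (split j) => k [l|l] /=;
  rewrite ?block_mxEul ?block_mxEur ?block_mxEdl ?block_mxEdr mxE.
Qed.

(** The matrix is block diagonal with one copy of [f] per element of [T1]; induction splits off one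
    copy at a time. *)
Lemma det_finmx_diag (T1 T2 : finType) (f : T2 -> T2 -> K) :
  \det (finmx (fun x y : T1 * T2 => f x.2 y.2 *+ (x.1 == y.1))) =
  \det (finmx f) ^+ #|T1|.
Proof.
(* Replacing [T1] by an ordinal type lets the induction run on its cardinality. *)
pose h (z : 'I_#|T1| * T2) : T1 * T2 := (enum_val z.1, z.2).
have h_bij : bijective h.
  by exists (fun z => (enum_rank z.1, z.2)) => [] [i x];
    rewrite /h /= ?enum_valK ?enum_rankK.
rewrite -(det_finmx_bij _ h_bij).
under eq_finmx do rewrite /h /= (inj_eq enum_val_inj).
elim: #|T1| => [|n IHn].
  rewrite expr0 -(@det1 K #|{: 'I_0 * T2}|); congr (\det _).
  by apply/matrixP=> i; case: (enum_val i) => -[].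
(* [g] separates the copy at [ord0] from the other [n] copies; no entry links them, as [ord0] is
   never a [lift ord0 i]. *)
pose g (z : T2 + 'I_n * T2) : 'I_n.+1 * T2 :=
  match z with inl x => (ord0, x) | inr (i, x) => (lift ord0 i, x) end.
pose g' (z : 'I_n.+1 * T2) : T2 + 'I_n * T2 :=
  if unlift ord0 z.1 is Some i then inr (i, z.2) else inl z.2.
have g_bij : bijective g.
  exists g' => [[x|[i x]]|[i x]]; rewrite /g' /= ?unlift_none ?liftK //.
  by case: unliftP => [j ->|->].
rewrite -(det_finmx_bij _ g_bij) det_finmx_sum.
have diag0 : finmx (fun x y => f (g (inl x)).2 (g (inr y)).2
                               *+ ((g (inl x)).1 == (g (inr y)).1)) = 0.
  by apply/matrixP=> i j; rewrite !mxE; case: (enum_val j) => k y.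
rewrite diag0 det_lblock exprS; congr (\det _ * _).
rewrite -IHn; congr (\det _); apply: eq_finmx => -[i x] [j y].
by rewrite /g /= (inj_eq lift_inj).
Qed.

(** * The Schur complement of the product and its rank reduction *)

Section SchurReduction.
Variables (V1 V2 : finType) (x : K).
Variables (a1 : V1 -> V1 -> K) (a2 c2 : V2 -> V2 -> K).
Variables (m1 : V1 -> K) (m2 : V2 -> K).
Hypothesis m1_sq : forall i, m1 i * m1 i = 1.
Hypothesis c2_inv : (x%:M - finmx a2) *m finmx c2 = 1%:M.

(* [finmx bb] is I (x) (x - A2), [finmx cc] its inverse, and [finmx ab] the
   a-to-b block of x - A. *)
Let chi := \sum_s \sum_t m2 s * c2 s t * m2 t.
Let bb (k l : V1 * V2) := (x *+ (k.2 == l.2) - a2 k.2 l.2) *+ (k.1 == l.1).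
Let cc (k l : V1 * V2) := c2 k.2 l.2 *+ (k.1 == l.1).
Let ab (k l : V1 * V2) := - (m1 k.1 * m2 l.2) *+ (k.1 == l.1).

Let sum_fst_eq (i : V1) (F : V1 * V2 -> K) :
  \sum_k F k *+ (i == k.1) = \sum_j F (i, j).
Proof.
transitivity (\sum_i' \sum_j F (i', j) *+ (i == i')).
  by rewrite pair_bigA; apply: eq_bigr => -[].
rewrite (bigD1 i) //= [X in _ + X]big1 ?addr0 => [|i' ni].
  by apply: eq_bigr => j _; rewrite eqxx.
by apply: big1 => j _; rewrite eq_sym (negPf ni).
Qed.

Let bb_inv : finmx bb *m finmx cc = 1%:M.
Proof.
rewrite mulmx_finmx scalar_finmx; apply: eq_finmx => -[i p] [j q].
move: c2_inv; rewrite scalar_finmx finmxB mulmx_finmx scalar_finmx.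
move=> /matrixP/(_ (enum_rank p) (enum_rank q)); rewrite !mxE !enum_rankK => c2I.
transitivity (\sum_k ((x *+ (p == k.2) - a2 p k.2) * c2 k.2 q *+ (k.1 == j))
                *+ (i == k.1)).
  by apply: eq_bigr => -[k r] _; rewrite /bb /cc /= mulrnAl mulrnAr.
by rewrite sum_fst_eq /= sumrMnl c2I xpair_eqE -mulrnA mulnb andbC.
Qed.

(** The two minus signs cancel, the sums over the b's collect [m2^T c2 m2 = chi], and the remaining
    [m1 i * m1 i] is 1. Second coordinates drop out, whence the factor J. *)
Let schur_complement :
  finmx ab *m finmx cc *m finmx (fun k l => ab l k) =
  finmx (fun k l => chi *+ (k.1 == l.1)).
Proof.
rewrite !mulmx_finmx; apply: eq_finmx => -[i p] [j q] /=.
transitivity (\sum_t (m1 i * m1 j * (\sum_s m2 s * c2 s t.2 * m2 t.2)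
                       *+ (t.1 == j)) *+ (i == t.1)).
  apply: eq_bigr => -[k t] _ /=.
  transitivity ((\sum_s (- (m1 i * m2 s.2) * c2 s.2 t *+ (s.1 == k))
                   *+ (i == s.1)) * ab (j, q) (k, t)).
    congr (_ * _); apply: eq_bigr => -[r s] _.
    by rewrite /ab /cc /= mulrnAl mulrnAr.
  rewrite sum_fst_eq /= sumrMnl mulrnAl; congr (_ *+ _).
  rewrite /ab /= mulrnAr eq_sym; congr (_ *+ _).
  rewrite mulr_suml mulr_sumr; apply: eq_bigr => s _.
  by ring.
rewrite sum_fst_eq /= sumrMnl; case: eqP => [->|]; rewrite ?mulr0n // !mulr1n.
by rewrite m1_sq /chi exchange_big; apply: eq_bigr => t _; rewrite mul1r.
Qed.

(** The power [x ^+ #|V1|] on the left comes from Sylvester's identity and stays there because [x]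
    may fail to be invertible in [K]. *)
Lemma det_corona_blocks :
  x ^+ #|V1| *
  \det (block_mx (x%:M - finmx (fun k l : V1 * V2 => a1 k.1 l.1)) (finmx ab)
                 (finmx (fun k l => ab l k)) (finmx bb)) =
  \det (x%:M - finmx a2) ^+ #|V1| * x ^+ (#|V1| * #|V2|) *
  \det ((x - #|V2|%:R * chi)%:M - #|V2|%:R *: finmx a1).
Proof.
rewrite (det_schur _ _ _ bb_inv) schur_complement.
rewrite (det_finmx_diag V1 (fun p q => x *+ (p == q) - a2 p q)).
rewrite (scalar_finmx V2 x) finmxB mulrCA -mulrA; congr (_ * _).
(* [U W] is (A1 + chi I) (x) J, while [W U] is only of order n1 and equals n2 (A1 + chi I), each
   first coordinate occurring n2 times. *)
pose U := finmx (fun (k : V1 * V2) i => a1 k.1 i + chi *+ (k.1 == i)).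
pose W := finmx (fun i (k : V1 * V2) => 1 *+ (i == k.1)).
have -> : x%:M - finmx (fun k l : V1 * V2 => a1 k.1 l.1)
          - finmx (fun k l => chi *+ (k.1 == l.1)) = x%:M - U *m W.
  rewrite -addrA -opprD; congr (_ - _); rewrite mulmx_finmx.
  apply/matrixP=> i j; rewrite !mxE (bigD1 (enum_val j).1) //= eqxx mulr1.
  by rewrite big1 ?addr0 // => k /negPf->; rewrite mulr0.
rewrite det_scalar_sub_mulC -card_prod; congr (_ * \det _).
rewrite mulmx_finmx.
have WU (i j : V1) :
    \sum_(k : V1 * V2) 1 *+ (i == k.1) * (a1 k.1 j + chi *+ (k.1 == j)) =
    #|V2|%:R * (a1 i j + chi *+ (i == j)).
  under eq_bigr do rewrite mulrnAl mul1r.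
  rewrite (sum_fst_eq i (fun k => a1 k.1 j + chi *+ (k.1 == j))) /=.
  by rewrite sumr_const mulr_natl.
apply/matrixP=> i j; rewrite !mxE WU (inj_eq enum_val_inj) mulrDr mulrnAr.
by rewrite mulrnBl; ring.
Qed.
End SchurReduction.
End MatricesOverFinTypes.

(** * Eigenvalues and denominators *)

Lemma det_scalar_sub_eigenvalues (R : rcfType) (K : fieldType)
    (f : {rmorphism R -> K}) n (A : 'M[R]_n) (lam : 'I_n -> R) (c y : K) :
  eigenvalues A lam -> c != 0 ->
  \det (y%:M - c *: map_mx f A) = \prod_(i < n) (y - c * f (lam i)).
Proof.
move=> lamP c0.
(* The factorisation of [char_poly A] is carried to [K] along [f] and evaluated at [z], which need
   not come from [R]. *)
have detE z : \det (z%:M - map_mx f A) = \prod_(i < n) (z - f (lam i)).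
  have := map_char_poly f A; rewrite lamP => /(congr1 (horner_eval z)).
  rewrite -[X in _ = X]det_map_mx rmorph_prod horner_evalE horner_prod.
  under eq_bigr do rewrite rmorphB /= map_polyX map_polyC !hornerE.
  move=> ->; congr (\det _); apply/matrixP=> i j.
  by rewrite !mxE /= horner_evalE !hornerE; case: (i == j); rewrite !hornerE.
have -> : y%:M - c *: map_mx f A = c *: ((c^-1 * y)%:M - map_mx f A).
  by rewrite scalerBr scale_scalar_mx mulVKf.
rewrite detZ detE -[n in c ^+ n]card_ord -prodr_const -big_split /=.
by apply: eq_bigr => i _; rewrite mulrBr mulVKf.
Qed.

(** Absorbs one factor F' into the term of the eigenvalue [l], with [p / f] the coronal. *)
Lemma clear_denominator (K : fieldType) (x n l p f : K) :
  f != 0 -> f * (x - n * (p / f) - n * l) = x * f - n * (l * f + p).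
Proof. by move=> f0; field. Qed.

(** * Characteristic polynomial of the product *)

Theorem theorem2 (R : rcfType) (V1 V2 : finType)
    (S1 : signed_graph V1) (S2 : signed_graph V2)
    (n2_gt0 : (0 < #|V2|)%N)
    (lam : 'I_#|V1| -> R)
    (lamP : eigenvalues (adjmx R (mu_signed S1)) lam)
    (d : nat) (P F G : {poly R})
    (redP : coronal_reduced_form (mu_signed S2) d P F G) :
  char_poly (adjmx R (sgprod S1 S2)) =
    'X^(#|V1| * (#|V2| - 1)) * G ^+ #|V1| *
    \prod_(i < #|V1|) ('X * F - #|V2|%:R * ((lam i)%:P * F + P)).
Proof.
case: redP => chiE _ szF _ denE.
have F0 : F != 0 by rewrite -size_poly_gt0 szF.
have FF0 : F%:F != 0 by rewrite tofrac_eq0.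
pose iota : {rmorphism R -> {fraction {poly R}}} :=
  @FracField.tofrac {poly R} \o polyC.
pose x : {fraction {poly R}} := 'X%:F.
pose adjf (V : finType) (S : signed_graph V) (u v : V) : {fraction {poly R}} :=
  iota (if adj S u v then (sigma S u v)%:~R else 0).
pose m (V : finType) (S : signed_graph V) (u : V) : {fraction {poly R}} :=
  iota (mark S u)%:~R.
have adjE (V : finType) (S : signed_graph V) :
    finmx (adjf V S) = map_mx iota (adjmx R S).
  by apply/matrixP=> i j; rewrite !mxE.
have char_polyE (V : finType) (S : signed_graph V) :
    (char_poly (adjmx R S))%:F = \det (x%:M - finmx (adjf V S)).
  by rewrite adjE /char_poly -det_map_mx -char_poly_mx_frac.
have m_sq (V : finType) (S : signed_graph V) u : m V S u * m V S u = 1.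
  by rewrite -rmorphM -intrM; case: (mark_sign S u) => ->; rewrite ?mulrNN rmorph1.
have mM i q : iota (mark S1 i * mark S2 q)%:~R = m _ S1 i * m _ S2 q.
  by rewrite intrM rmorphM.
pose A2 := x%:M - finmx (adjf _ (mu_signed S2)).
have A2u : A2 \in unitmx.
  by rewrite unitmxE unitfE -char_polyE tofrac_eq0 coronal_den_neq0.
pose c2 (p q : V2) := invmx A2 (enum_rank p) (enum_rank q).
have c2_inv : A2 *m finmx c2 = 1%:M by rewrite finmx_rank mulmxV.
(* The marks of [mu_signed S2] are those of [S2], so this double sum is the coronal written
   entrywise, up to the order of summation. *)
have chi_c2 : \sum_s \sum_t m _ S2 s * c2 s t * m _ S2 t = P%:F / F%:F.
  rewrite -chiE /coronal mxE exchange_big.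
  rewrite (reindex _ (onW_bij _ (enum_val_bij V2))); apply: eq_bigr => j _.
  rewrite [X in _ = X * _]mxE mulr_suml.
  rewrite (reindex _ (onW_bij _ (enum_val_bij V2))); apply: eq_bigr => i _.
  by rewrite /c2 /A2 adjE !enum_valK !mxE.
have x0 : x != 0 by rewrite tofrac_eq0 polyX_eq0.
have n20 : #|V2|%:R != 0 :> {fraction {poly R}}.
  by rewrite -(rmorph_nat iota) fmorph_eq0 pnatr_eq0 -lt0n.
(* Both sides are multiplied by [x ^+ #|V1|], the factor in [det_corona_blocks]; it cancels since x
   is nonzero among fractions. *)
apply/eqP; rewrite -tofrac_eq; apply/eqP/(mulfI (expf_neq0 #|V1| x0)).
rewrite char_polyE scalar_finmx finmxB det_finmx_sum.
have := det_corona_blocks (adjf _ (mu_signed S1)) (m _ S2) (m_sq _ S1) c2_inv.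
rewrite chi_c2 -char_polyE => schurE; apply: etrans (etrans _ schurE) _.
  (* Every sign is a product of marks, both in the product and in the mu-signed factors, so the four
     blocks agree entry by entry. *)
  congr (_ * \det (block_mx _ _ _ _)).
  - by rewrite scalar_finmx finmxB; apply: eq_finmx => -[i p] [j q].
  - apply: eq_finmx => -[i p] [j q]; rewrite -mM /adjf /= sub0r.
    by case: (i == j); rewrite ?rmorph0 ?oppr0.
  - apply: eq_finmx => -[i p] [j q]; rewrite -mM /adjf /= sub0r.
    rewrite (eq_sym j) [mark S1 _ * _]mulrC.
    by case: (i == j); rewrite ?rmorph0 ?oppr0.
  - apply: eq_finmx => -[i p] [j q]; rewrite /adjf /=.
    rewrite -[inr _ == inr _]/((i == j) && (p == q)).
    by case: (i == j); rewrite ?rmorph0 ?subr0.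
rewrite adjE (det_scalar_sub_eigenvalues iota _ lamP n20).
rewrite -/(coronal_den R (mu_signed S2)) denE.
(* The F'^n1 contained in f2^n1 is shared out, one factor per eigenvalue. *)
have factorE : F%:F ^+ #|V1| *
    \prod_(i < #|V1|) (x - #|V2|%:R * (P%:F / F%:F) - #|V2|%:R * iota (lam i)) =
    (\prod_(i < #|V1|) ('X * F - #|V2|%:R * ((lam i)%:P * F + P)))%:F.
  rewrite rmorph_prod -[in F%:F ^+ _](card_ord #|V1|) -prodr_const -big_split.
  apply: eq_bigr => i _ /=.
  rewrite tofracB !tofracM tofracD tofracM rmorph_nat -/x.
  by rewrite (clear_denominator _ _ _ _ FF0).
(* The subtraction is truncated, so [n2_gt0] matters; the split-off x^n1 matches the factor
   introduced above. *)
have -> : (#|V1| * #|V2| = #|V1| + #|V1| * (#|V2| - 1))%N.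
  by rewrite -mulnS subn1 prednK.
rewrite !tofracM !tofracXn -factorE exprD exprMn -/x.
have reorder (K : comNzRingType) (g f a b p : K) :
    g * f * (a * b) * p = a * (b * g * (f * p)) by ring.
by rewrite reorder.
Qed.
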